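(* Let $d\ge 3$ and let $\Delta$ be a balanced normal $(d-1)$-pseudomanifold. Then $\overline{g}_2(\Delta)\ge 0$, i.e. $2h_2(\Delta)\ge (d-1)h_1(\Delta)$.
   Context: A $(d-1)$-dimensional simplicial complex $\Delta$ is balanced if its vertex set can be partitioned as $V_1\amalg\cdots\amalg V_d$ so that every face contains at most one vertex of each $V_i$ (i.e. the graph of $\Delta$ is properly $d$-colored; $V_i$ is the set of vertices of color $i$). A $(d-1)$-dimensional simplicial complex is a normal $(d-1)$-pseudomanifold if it is connected and pure, every $(d-2)$-face lies in exactly two facets, and the link of every face of dimension $\le d-3$ is connected. With $f_{i}(\Delta)$ the number of $i$-dimensional faces ($f_{-1}=1$), the $h$-numbers are $h_j(\Delta)=\sum_{i=0}^{j}(-1)^{j-i}\binom{d-i}{d-j}f_{i-1}(\Delta)$, and the balanced $g$-numbers are $\overline{g}_j(\Delta)=j\,h_j(\Delta)-(d-j+1)h_{j-1}(\Delta)$ for $1\le j\le d$. *)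

(* Defs.v *)
From HB Require Import structures.
From mathcomp Require Import all_boot all_order all_algebra.

Set Implicit Arguments.
Unset Strict Implicit.
Unset Printing Implicit Defensive.

Import Order.TTheory GRing.Theory Num.Theory.

Section SimplicialComplexes.
Variable T : finType.
Implicit Types (D : {set {set T}}) (F G : {set T}).

(* A complex is given by its set of faces. Elements of T need not be vertices;
   the dimension of a face F is #|F| - 1, the empty face having dimension -1. *)
Definition simplicial_complex D : Prop :=
  set0 \in D /\ (forall F G, F \in D -> G \subset F -> G \in D).

Definition vertices D : {set T} := [set v | [set v] \in D].

Definition dim_succ D : nat := \max_(F in D) #|F|.

Definition facets D : {set {set T}} :=
  [set F | maxset (fun G : {set T} => G \in D) F].

Definition link D F : {set {set T}} :=
  [set G : {set T} | [disjoint G & F] && (G :|: F \in D)].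

(* Connectedness of the graph (1-skeleton); since [set u; u] = [set u], the
   relation has harmless loops at the vertices. *)
Definition connected_complex D : Prop :=
  forall u v, u \in vertices D -> v \in vertices D ->
    connect (fun x y => [set x; y] \in D) u v.

Definition pure D : Prop := forall F, F \in facets D -> #|F| = dim_succ D.

Definition balanced (d : nat) D : Prop :=
  dim_succ D = d /\
  exists V : 'I_d -> {set T},
    [/\ \bigcup_i V i = vertices D,
        forall i j, i != j -> [disjoint V i & V j] &
        forall F i, F \in D -> #|F :&: V i| <= 1].

(* Normal (d-1)-pseudomanifold. Cardinality d.-1 is dimension d-2, and
   #|F| + 2 <= d is dimension at most d-3. *)
Definition normal_pseudomanifold (d : nat) D : Prop :=
  [/\ dim_succ D = d,
      connected_complex D,
      pure D,
      forall F, F \in D -> #|F| = d.-1 ->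
        #|[set G in facets D | F \subset G]| = 2 &
      forall F, F \in D -> #|F| + 2 <= d -> connected_complex (link D F)].

(* Number of faces with i vertices, i.e. f_{i-1}. *)
Definition fcard D (i : nat) : nat := #|[set F in D | #|F| == i]|.

Local Open Scope ring_scope.

(* Meaningful for j <= d, where the natural number subtractions are exact. *)
Definition hnum (d : nat) D (j : nat) : int :=
  \sum_(0 <= i < j.+1)
    (-1) ^+ (j - i) * ('C(d - i, d - j))%:Z * (fcard D i)%:Z.

(* Meaningful for 1 <= j <= d. *)
Definition balanced_gnum (d : nat) D (j : nat) : int :=
  j%:Z * hnum d D j - (d%:Z - j%:Z + 1) * hnum d D j.-1.

End SimplicialComplexes.

(* Main.v *)
(** For a triple K of colours, the part Delta_K of Delta spanned by the colours in
    K has f_1 >= 3 f_0 - 6; averaging this over all K gives the theorem.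

    The facets containing a face C that uses exactly the colours outside K form a
    connected closed surface S on the colours K. By strong connectivity, Delta_K is
    obtained from a single triangle by repeatedly adding all the vertices of such a
    surface S of which some triangle is already present. It therefore suffices that
    a set W of vertices of S which misses some triangle meets at least 3|W| edges.

    One may take W connected. Let E and T be the sets of edges and triangles that
    meet W. The F_2-chain complex of T, E and W (the chains of S relative to the
    part induced outside W) has H_0 = 0 and dim H_2 <= 1, hence
    |W| - |E| + |T| <= 1. On the other hand the mod 2 boundary of T is a nonempty
    cycle in a simple graph, so it has at least 3 edges, and counting incidences
    gives 3|T| >= 2|E| + 3. *)
Require Import Defs.
From mathcomp Require Import all_boot all_order all_algebra zify.

Set Implicit Arguments.
Unset Strict Implicit.
Unset Printing Implicit Defensive.

Import Order.TTheory GRing.Theory Num.Theory.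

(** * Rank counts and binomial counts *)

Section RankCount.
Local Open Scope ring_scope.
Variables (X Y Z : finType) (A : {set X}) (B : {set Y}) (C : {set Z}).
Variables (r : X -> Y -> bool) (s : Y -> Z -> bool).

(* Rank count for A -> B -> C over F_2: exactness at C, and a kernel of dimension
   at most 1 at A. *)
Lemma card_boundary_complex :
  (forall x z, x \in A -> z \in C ->
     ~~ odd #|[set y in B | r x y && s y z]|) ->
  (forall f : Z -> 'F_2,
     (forall y, y \in B -> \sum_(z in C | s y z) f z = 0) ->
     forall z, z \in C -> f z = 0) ->
  (forall f : X -> 'F_2,
     (forall y, y \in B -> \sum_(x in A | r x y) f x = 0) ->
     exists c, forall x, x \in A -> f x = c) ->
  (#|A| + #|C| <= #|B|.+1)%N.
Proof.
move=> rs0 sinj rker.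
pose M := \matrix_(i < #|A|, j < #|B|) ((r (enum_val i) (enum_val j))%:R : 'F_2).
pose N := \matrix_(i < #|B|, j < #|C|) ((s (enum_val i) (enum_val j))%:R : 'F_2).
(* [ext] reads a row vector as a function on the whole type, zero outside [E]. *)
pose ext (U : finType) (E : {set U}) (v : 'rV['F_2]_#|E|) x :=
  \sum_(i | enum_val i == x) v 0 i.
have extE U (E : {set U}) (v : 'rV['F_2]_#|E|) i : ext U E v (enum_val i) = v 0 i.
  by rewrite /ext (big_pred1 i) // => j /=; rewrite (inj_eq enum_val_inj).
have MN0 : M *m N = 0.
  apply/matrixP=> i j; rewrite !mxE.
  under eq_bigr do rewrite !mxE -natrM mulnb.
  rewrite -(big_enum_val (A := mem B) (fun y => (r (enum_val i) y && s y (enum_val j))%:R)) /=.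
  rewrite -natr_sum -big_mkcondr /= sum1_card.
  have /negbTE := rs0 _ _ (enum_valP i) (enum_valP j).
  rewrite cardsE => ev.
  by rewrite -[n in n%:R]odd_double_half ev -muln2 natrM (_ : 2%:R = 0) ?mulr0 //; apply/val_inj.
(* Exactness at [C] enters in dual form: the transpose of [N] is injective. *)
have rN : \rank N = #|C|.
  rewrite -mxrank_tr; apply/eqP; rewrite -/(row_free _) -kermx_eq0.
  apply/rowV0P => v /sub_kermxP vN0; apply/rowP => j; rewrite mxE -extE.
  apply: sinj (enum_valP j) => y yB.
  have := congr1 (fun w : 'rV_ _ => w 0 (enum_rank_in yB y)) vN0; rewrite !mxE => e0; rewrite -[RHS]e0.
  under [RHS]eq_bigr do rewrite !mxE enum_rankK_in // -extE.
  rewrite -(big_enum_val (A := mem C) (fun z => ext _ C v z * (s y z)%:R)). rewrite big_mkcondr /=.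
  by apply: eq_bigr => z _; case: (s y z); rewrite ?mulr1 ?mulr0.
have rM : (\rank (kermx M) <= 1)%N.
  apply: leq_trans (rank_leq_row (const_mx 1 : 'rV['F_2]_#|A|)).
  apply/mxrankS/row_subP => k; set v := row k _.
  have vM0 : v *m M = 0 by apply/sub_kermxP; rewrite row_sub.
  have [y yB|c cE] := rker (ext _ A v).
    have := congr1 (fun w : 'rV_ _ => w 0 (enum_rank_in yB y)) vM0; rewrite !mxE => e0; rewrite -[RHS]e0.
    under [RHS]eq_bigr do rewrite [M _ _]mxE enum_rankK_in // -extE.
    rewrite -(big_enum_val (A := mem A) (fun x => ext _ A v x * (r x y)%:R)) big_mkcondr /=.
    by apply: eq_bigr => z _; case: (r z y); rewrite ?mulr1 ?mulr0.
  suff -> : v = c *: const_mx 1 by apply: scalemx_sub.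
  by apply/rowP => j; rewrite -extE cE ?enum_valP // !mxE mulr1.
have := mulmx0_rank_max MN0; rewrite rN.
move: rM; rewrite mxrank_ker; lia.
Qed.

End RankCount.

(** Such a set is [A] together with an arbitrary part of [B :\: A] of size [k - #|A|]. *)
Lemma card_draws_between (U : finType) (A B : {set U}) k :
  A \subset B -> #|A| <= k ->
  #|[set K : {set U} | [&& A \subset K, K \subset B & #|K| == k]]|
    = 'C(#|B| - #|A|, k - #|A|).
Proof.
move=> sAB leAk; rewrite -cardsDS // -cards_draws.
rewrite -[RHS](@card_in_imset _ _ (fun L => A :|: L)) => [|L1 L2]; last first.
  rewrite !inE !subsetD => /andP[/andP[_ d1] _] /andP[/andP[_ d2] _] /setP e.
  apply/setP => x; have := e x; rewrite !inE.
  by case xA: (x \in A) => //= _; rewrite (disjointFl d1) // (disjointFl d2).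
apply: eq_card => K; rewrite inE; apply/and3P/imsetP => [[sAK sKB /eqP Kk]|[L]].
  exists (K :\: A); last by rewrite -[LHS](setID K A) (setIidPr sAK).
  by rewrite inE setSD //= cardsDS // Kk.
rewrite inE subsetD => /andP[/andP[sLB dLA] /eqP Lk] ->; split.
- exact: subsetUl.
- by rewrite subUset sAB.
- by rewrite cardsU Lk disjoint_setI0 1?disjoint_sym // cards0 subn0 subnKC.
Qed.

(** * Closed surfaces *)

Section Surface.
Variables (T : finType) (S : {set {set T}}).
Implicit Types (F G e : {set T}) (W : {set T}).

(* [S] is the set of triangles of a connected closed surface. Connectivity is
   expressed by the propagation of predicates to adjacent triangles, which is the
   form in which it is both obtained and used. *)
Hypothesis card_tri : forall F, F \in S -> #|F| = 3.
Hypothesis two_tri : forall e F, F \in S -> e \subset F -> #|e| = 2 ->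
  #|[set G in S | e \subset G]| = 2.
Hypothesis conn_star : forall w (P : pred {set T}),
  (forall F G, F \in S -> G \in S -> w \in F -> w \in G ->
     #|F :&: G| = 2 -> P F -> P G) ->
  forall F G, F \in S -> G \in S -> w \in F -> w \in G -> P F -> P G.
Hypothesis conn_tri : forall P : pred {set T},
  (forall F G, F \in S -> G \in S -> #|F :&: G| = 2 -> P F -> P G) ->
  forall F G, F \in S -> G \in S -> P F -> P G.

(** * Incidences of edges and triangles meeting a vertex set *)

Definition tri_edge e := (#|e| == 2) && [exists F in S, e \subset F].
Definition edges_at W := [set e | tri_edge e & ~~ [disjoint e & W]].
Definition tris_at W := [set F in S | ~~ [disjoint F & W]].

Lemma tri_edgeP e :
  reflect (#|e| = 2 /\ exists2 F, F \in S & e \subset F) (tri_edge e).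
Proof.
apply: (iffP andP) => [[/eqP -> /exists_inP]|[-> eS]] //.
by split=> //; apply/exists_inP.
Qed.

Lemma card_tris_edge e : tri_edge e -> #|[set G in S | e \subset G]| = 2.
Proof. by case/tri_edgeP=> e2 [F FS sF]; apply: two_tri sF e2. Qed.

Lemma tris_atS W F : F \in tris_at W -> F \in S.
Proof. by rewrite inE => /andP[]. Qed.

Definition deg_at W e := #|[set F in tris_at W | e \subset F]|.

Lemma deg_at_le2 W e : #|e| = 2 -> deg_at W e <= 2.
Proof.
move=> e2; rewrite /deg_at.
have [->|[F]] := set_0Vmem [set F in tris_at W | e \subset F]; first by rewrite cards0.
rewrite inE => /andP[/tris_atS FS sF]; rewrite -(two_tri FS sF e2).
apply/subset_leq_card/subsetP => G; rewrite !inE => /andP[/andP[-> _]] //.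
Qed.

(** A triangle containing an edge that meets [W] meets [W] itself, so both triangles at that edge
    are counted. *)
Lemma deg_at_edge W e : e \in edges_at W -> deg_at W e = 2.
Proof.
rewrite inE => /andP[eE eW]; rewrite -(card_tris_edge eE).
apply: eq_card => F; rewrite !inE -andbA; congr (_ && _); apply/andP/idP => [[]//|sF].
by split=> //; apply: contra eW => /disjointWl; apply.
Qed.

(* The mod 2 boundary of [tris_at W]. *)
Definition bdry W := [set e : {set T} | (#|e| == 2) && (deg_at W e == 1)].

Lemma sum_deg_at W : \sum_(e : {set T} | #|e| == 2) deg_at W e = 3 * #|tris_at W|.
Proof.
rewrite /deg_at; under eq_bigr do rewrite -sum1dep_card big_mkcondr /=.
rewrite exchange_big /= mulnC -sum_nat_const; apply: eq_bigr => F /tris_atS /card_tri F3.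
rewrite -big_mkcondr /= sum1dep_card -[RHS]/('C(3, 2)) -F3 -cards_draws.
by apply: eq_card => e; rewrite !inE andbC.
Qed.

(** Each triangle contributes the number of its edges through [u], which is 0 or 2. *)
Lemma sum_deg_vertex W u :
  ~~ odd (\sum_(e : {set T} | (#|e| == 2) && (u \in e)) deg_at W e).
Proof.
rewrite /deg_at; under eq_bigr do rewrite -sum1dep_card big_mkcondr /=.
rewrite exchange_big /= big_mkcond /= -dvdn2; apply: dvdn_sum => F _.
case: ifP => // /tris_atS /card_tri F3; rewrite -big_mkcondr /= sum1dep_card.
have [uF|uF] := boolP (u \in F); last first.
  rewrite eq_card0 // => e; rewrite !inE; apply/negP => /andP[/andP[_ ue] /subsetP/(_ _ ue)].
  exact/negP.
have := @card_draws_between _ [set u] F 2; rewrite sub1set uF cards1 F3 => /(_ isT isT).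
rewrite (eq_card (B := [set e : {set T} | ((#|e| == 2) && (u \in e)) && (e \subset F)])).
  by move=> ->.
by move=> e; rewrite !inE sub1set; do !case: (_ \in _) (_ \subset _) (_ == _) => [] [] [].
Qed.

(** The degrees at [u] have even sum, so another edge at [u] has odd degree; degrees are at most 2,
    so that degree is 1. *)
Lemma bdry_even W u e :
  e \in bdry W -> u \in e -> exists2 e', e' \in bdry W & (u \in e') && (e' != e).
Proof.
move=> eB ue; move: (eB); rewrite inE => /andP[e2 /eqP e1].
have := sum_deg_vertex W u; rewrite (bigD1 e) /= ?e2 // e1 add1n /= negbK => od.
have /exists_inP[e' /andP[/andP[e'2 ue'] ne] od'] :
    [exists (e' : {set T} | ((#|e'| == 2) && (u \in e')) && (e' != e)), odd (deg_at W e')].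
  apply: contraLR od => /exists_inPn ev.
  by rewrite -dvdn2; apply: dvdn_sum => e' /ev; rewrite dvdn2.
exists e'; last by rewrite ue'.
rewrite inE e'2 /=; move: od' (deg_at_le2 W (eqP e'2)).
by case: deg_at => [|[|[|]]].
Qed.

(** Continuing the boundary past each end of an edge gives two further edges; if they coincided,
    they would contain both ends and equal the first edge. *)
Lemma bdry_gt2 W : bdry W != set0 -> 3 <= #|bdry W|.
Proof.
case/set0Pn=> e eB; have /cards2P[u [v [neuv eE]]] : #|e| == 2 by move: eB; rewrite inE => /andP[].
have [|e1 e1B /andP[ue1 ne1]] := bdry_even (u := u) eB; first by rewrite eE !inE eqxx.
have [|e2 e2B /andP[ve2 ne2]] := bdry_even (u := v) eB; first by rewrite eE !inE eqxx orbT.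
have ne12 : e1 != e2.
  apply: contra ne1 => /eqP e12; rewrite eq_sym eqEcard eE subUset !sub1set ue1 e12 ve2 /= cards2 neuv.
  by move: e2B; rewrite inE => /andP[/eqP ->].
rewrite -(_ : #|[set e; e1; e2]| = 3).
  by apply/subset_leq_card/subsetP => x; rewrite !inE -orbA => /or3P[]/eqP -> //;
     [move: eB|move: e1B|move: e2B]; rewrite inE.
by rewrite -setUA cardsU1 cards2 !inE negb_or ![e == _]eq_sym ne1 ne2 ne12.
Qed.

(** With an empty boundary, [tris_at W] would be closed under adjacency, hence by connectivity would
    contain [G]. *)
Lemma bdry_neq0 W F G : F \in tris_at W -> G \in S -> [disjoint G & W] ->
  bdry W != set0.
Proof.
move=> FW GS dGW; apply/negP => /eqP B0; move: dGW; apply/negP.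
suff: G \in tris_at W by rewrite inE GS.
apply: (conn_tri (P := fun H => H \in tris_at W) _ (tris_atS FW) GS FW) => F1 F2 F1S F2S I2 F1W.
have lt1 : 1 < deg_at W (F1 :&: F2).
  have : F1 :&: F2 \notin bdry W by rewrite B0 inE.
  rewrite inE I2 eqxx /=.
  have : 0 < deg_at W (F1 :&: F2).
    by apply/card_gt0P; exists F1; rewrite inE F1W subsetIl.
  by case: deg_at => [|[|]].
have sub : [set F in tris_at W | F1 :&: F2 \subset F] \subset [set F in S | F1 :&: F2 \subset F].
  by apply/subsetP => H; rewrite !inE => /andP[/andP[-> _]].
have /eqP E : [set F in tris_at W | F1 :&: F2 \subset F] == [set F in S | F1 :&: F2 \subset F].
  by rewrite eqEcard sub (two_tri F1S (subsetIl _ _) I2).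
have : F2 \in [set F in S | F1 :&: F2 \subset F] by rewrite inE F2S subsetIr.
by rewrite -E inE => /andP[].
Qed.

(** Of the degree sum [3 * #|tris_at W|], each edge meeting [W] takes 2, and each boundary edge,
    which avoids [W], takes 1. *)
Lemma edges_tris_at W F G : F \in tris_at W -> G \in S -> [disjoint G & W] ->
  2 * #|edges_at W| + 3 <= 3 * #|tris_at W|.
Proof.
move=> FW GS dGW; have B3 := bdry_gt2 (bdry_neq0 FW GS dGW).
rewrite -sum_deg_at; apply: leq_trans (_ : 2 * #|edges_at W| + #|bdry W| <= _).
  by rewrite leq_add2l.
rewrite (bigID (mem (edges_at W))) /=; apply: leq_add.
  rewrite mulnC -sum_nat_const big_mkcond [X in _ <= X]big_mkcond /=; apply: leq_sum => e _.
  case: ifP => // eW; rewrite (deg_at_edge eW).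
  by move: eW; rewrite inE => /andP[/andP[-> _] _].
rewrite -sum1_card big_mkcond [X in _ <= X]big_mkcond /=; apply: leq_sum => e _.
case: ifP => //; rewrite inE => /andP[-> /eqP d1] /=; case: ifP; rewrite ?d1 //.
by move/negbFE/deg_at_edge; rewrite d1.
Qed.

(** * The Euler characteristic count and the edge bound *)

Lemma edge_of_tri F x y : F \in S -> x \in F -> y \in F -> x != y -> tri_edge [set x; y].
Proof.
move=> FS xF yF ne; apply/tri_edgeP; rewrite cards2 ne; split=> //; exists F => //.
by rewrite subUset !sub1set xF.
Qed.

Lemma F2_addr_eq0 (a b : 'F_2) : (a + b = 0)%R -> a = b.
Proof.
move/eqP; rewrite addr_eq0 => /eqP ->.
by case: b => [[|[|]]] // ?; apply/val_inj.
Qed.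

(* The assumption on predicates says that [W] induces a connected graph. *)
Lemma euler_connected W x0 G :
  x0 \in W -> (forall w, w \in W -> exists2 F, F \in S & w \in F) ->
  (forall P : pred T, P x0 ->
     (forall F x y, F \in S -> x \in F -> y \in F -> x \in W -> y \in W -> P x -> P y) ->
     forall y, y \in W -> P y) ->
  G \in S -> [disjoint G & W] ->
  #|tris_at W| + #|W| <= #|edges_at W|.+1.
Proof.
move=> x0W WS Wconn GS dGW.
apply: (@card_boundary_complex _ _ _ _ _ _ (fun F e => e \subset F) (fun e w => w \in e)).
(* The boundary of a boundary vanishes: a triangle has two edges or none through [w]. *)
- move=> F w FW wW; have F3 := card_tri (tris_atS FW).
  have [wF|wF] := boolP (w \in F); last first.
    rewrite eq_card0 // => e; rewrite inE; apply/negP => /and3P[_ /subsetP s /s].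
    exact/negP.
  have := @card_draws_between _ [set w] F 2; rewrite sub1set wF cards1 F3 => /(_ isT isT).
  rewrite (eq_card (B := [set e in edges_at W | (e \subset F) && (w \in e)])).
    by move=> ->.
  move=> e; rewrite !inE sub1set; apply/and3P/and3P => [[we sF e2]|[/andP[/andP[e2 _] _] sF we]] //.
  split=> //; rewrite /tri_edge e2 /=; apply/andP; split.
    by apply/exists_inP; exists F; rewrite ?(tris_atS FW).
  by apply/pred0Pn; exists w; rewrite /= we.
(* H_0 = 0, dually: [f] extended by zero takes equal values at the ends of every edge, so its
   vanishing on [G] spreads to all triangles. *)
- move=> f f0; pose g x := if x \in W then f x else 0%R.
  have gE F x y : F \in S -> x \in F -> y \in F -> g x = g y.
    move=> FS xF yF; have [->//|ne] := eqVneq x y.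
    have [xyW|] := boolP ([set x; y] \in edges_at W).
      by apply: F2_addr_eq0; rewrite -[RHS](f0 _ xyW) big_mkcondl /= big_setU1 ?inE // big_set1.
    rewrite inE (edge_of_tri FS) //= negbK => dW.
    by rewrite /g !(disjointFr dW) ?inE ?eqxx ?orbT.
  have g0 F : F \in S -> [forall x in F, g x == 0%R].
    move=> FS; apply: (conn_tri (P := fun H => [forall x in H, g x == 0%R]) _ GS FS).
      move=> F1 F2 F1S F2S I2 /forall_inP F10; apply/forall_inP => y yF2.
      have /card_gt0P[x] : 0 < #|F1 :&: F2| by rewrite I2.
      by rewrite inE => /andP[xF1 xF2]; rewrite (gE F2 y x) ?F10.
    by apply/forall_inP => x xG; rewrite /g (disjointFr dGW).
  move=> z zW; have [F FS zF] := WS z zW.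
  by have /forall_inP/(_ z zF)/eqP := g0 F FS; rewrite /g zW.
(* H_2 has dimension at most 1: [f] agrees on the two triangles at each edge meeting [W], so it is
   constant on the star of each vertex of [W]. Stars of adjacent vertices share a triangle. *)
- move=> f f0; have [F0 F0S x0F0] := WS x0 x0W.
  exists (f F0).
  have star w : w \in W -> forall F, F \in S -> w \in F -> f F = f F0 ->
      forall F', F' \in S -> w \in F' -> f F' == f F0.
    move=> wW F FS wF fF F' F'S wF'.
    apply: (conn_star (w := w) (P := fun H => f H == f F0) _ FS F'S) => //; last exact/eqP.
    move=> F1 F2 F1S F2S w1 w2 I2 /eqP <-.
    have eE : F1 :&: F2 \in edges_at W.
      rewrite inE; apply/andP; split.
        by apply/tri_edgeP; split=> //; exists F1; rewrite ?subsetIl.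
      by apply/pred0Pn; exists w; rewrite /= inE w1 w2.
    have /eqP/cards2P[H1 [H2 [neH HE]]] := deg_at_edge eE.
    have := f0 _ eE.
    rewrite (eq_bigl (mem [set H1; H2])) => [|H]; last by rewrite -HE !inE.
    have inW H : H \in S -> w \in H -> H \in tris_at W.
      by move=> HS wH; rewrite inE HS; apply/pred0Pn; exists w; rewrite /= wH.
    have : F1 \in [set H1; H2] by rewrite -HE inE inW ?subsetIl.
    have : F2 \in [set H1; H2] by rewrite -HE inE inW ?subsetIr.
    rewrite big_setU1 ?inE // big_set1 => + + /F2_addr_eq0 e.
    by rewrite ?inE => /orP[]/eqP-> /orP[]/eqP->; rewrite ?e.
  have all_w y : y \in W -> [forall F in S, (y \in F) ==> (f F == f F0)].
    apply: (Wconn (fun y => [forall F in S, (y \in F) ==> (f F == f F0)])).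
      by apply/forall_inP => F FS; apply/implyP; apply: (star _ x0W F0).
    move=> F x z FS xF zF xW zW /forall_inP/(_ F FS); rewrite xF /= => /eqP fF.
    by apply/forall_inP => F' F'S; apply/implyP; apply: (star _ zW F).
  move=> F FW; move: (FW); rewrite inE => /andP[FS /pred0Pn[w /andP[/= wF wW]]].
  by have /forall_inP/(_ F FS) := all_w w wW; rewrite wF => /eqP.
Qed.

(** With w, e, t the numbers of vertices, edges and triangles, the Euler bound and [edges_tris_at]
    give 3w <= 3e + 3 - 3t <= e. *)
Lemma edges_at_ge3_connected W x0 G :
  x0 \in W -> (forall w, w \in W -> exists2 F, F \in S & w \in F) ->
  (forall P : pred T, P x0 ->
     (forall F x y, F \in S -> x \in F -> y \in F -> x \in W -> y \in W -> P x -> P y) ->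
     forall y, y \in W -> P y) ->
  G \in S -> [disjoint G & W] ->
  3 * #|W| <= #|edges_at W|.
Proof.
move=> x0W WS Wconn GS dGW.
have := euler_connected x0W WS Wconn GS dGW.
have [F FS x0F] := WS x0 x0W.
have FW : F \in tris_at W by rewrite inE FS; apply/pred0Pn; exists x0; rewrite /= x0F.
have := edges_tris_at FW GS dGW.
by move: #|W| #|edges_at W| #|tris_at W| => w e t; lia.
Qed.

(** Induction on [#|W|], splitting off the component [C] of a vertex: no edge meets both [C] and
    [W :\: C], so the two bounds add up. *)
Lemma edges_at_ge3 W G :
  (forall w, w \in W -> exists2 F, F \in S & w \in F) ->
  G \in S -> [disjoint G & W] -> 3 * #|W| <= #|edges_at W|.
Proof.
have [n] := ubnP #|W|; elim: n W => // n IHn W ltn WS GS dGW.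
have [->|[x0 x0W]] := set_0Vmem W; first by rewrite cards0.
pose r x y := [&& x \in W, y \in W & [exists F in S, (x \in F) && (y \in F)]].
pose C := [set y in W | connect r x0 y].
have x0C : x0 \in C by rewrite inE x0W connect0.
have sCW : C \subset W by apply/subsetP => x; rewrite inE => /andP[].
have geC : 3 * #|C| <= #|edges_at C|.
  apply: (edges_at_ge3_connected x0C) GS _.
  - by move=> w /(subsetP sCW); apply: WS.
  - move=> P Px0 Pr y; rewrite inE => /andP[_ /connectP[p pp ->]].
    suff ind x q : path r x q -> P x && (x \in C) -> P (last x q) && (last x q \in C).
      by have /andP[] := ind _ _ pp (introT andP (conj Px0 x0C)).
    elim: q x => //= z q IHq x /andP[rxz pq] /andP[Px xC].
    apply: IHq pq _; move: (rxz) => /and3P[xW zW /exists_inP[F FS /andP[xF zF]]].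
    have zC : z \in C.
      by move: xC; rewrite !inE zW => /andP[_ /connect_trans]; apply; apply: connect1.
    by rewrite zC (Pr F x z).
  - exact: disjointWr dGW.
have geW : 3 * #|W :\: C| <= #|edges_at (W :\: C)|.
  apply: IHn GS _.
  - apply: leq_trans (_ : #|W| <= n); last by rewrite -ltnS.
    apply/proper_card/properP; split; first exact: subsetDl.
    by exists x0; rewrite // inE x0C.
  - by move=> w; rewrite inE => /andP[_]; apply: WS.
  - by apply: disjointWr dGW; apply: subsetDl.
rewrite -(cardsID C W) (setIidPr sCW) mulnDr.
apply: leq_trans (leq_add geC geW) _.
have dE : [disjoint edges_at C & edges_at (W :\: C)].
  apply/pred0P => e /=; apply/negP => /andP[].
  rewrite !inE => /andP[/tri_edgeP[_ [F FS /subsetP sF]] /pred0Pn[x /andP[/= xe xC]]].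
  case/andP=> _ /pred0Pn[y /andP[/= ye]]; rewrite !inE => /andP[yC yW].
  case/negP: yC; rewrite yW /=; move: xC; rewrite inE => /andP[xW /connect_trans]; apply.
  by apply: connect1; rewrite /r xW yW; apply/exists_inP; exists F; rewrite ?sF.
rewrite -cardsUI (disjoint_setI0 dE) cards0 addn0; apply/subset_leq_card.
rewrite subUset; apply/andP; split; apply/subsetP => e; rewrite !inE => /andP[-> /=];
  apply: contra => /disjointWr; apply=> //; exact: subsetDl.
Qed.

End Surface.

(** * Normal pseudomanifolds *)

Section Facets.
Variables (d : nat) (T : finType) (D : {set {set T}}).
Hypothesis scD : simplicial_complex D.
Hypothesis npmD : normal_pseudomanifold d D.
Implicit Types (F G H : {set T}).

Lemma card_facet F : F \in facets D -> #|F| = d.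
Proof. by case: npmD => <- _ + _ _ => /(_ F); apply. Qed.

Lemma facet_face F : F \in facets D -> F \in D.
Proof. by rewrite inE => /maxsetP[]. Qed.

Lemma face_in_facet F : F \in D -> exists2 H, H \in facets D & F \subset H.
Proof.
by move=> /(@maxset_exists _ (fun G => G \in D))[H mH sFH]; exists H; rewrite ?inE.
Qed.

(** Induction on the codimension of [F0]. A path in the connected link of [F0] joins a vertex of [F]
    to one of [G], and the induction hypothesis at [z |: F0] spreads [P] over all facets through
    each vertex [z] of the path. *)
Lemma strongly_connected (P : pred {set T}) F0 :
  F0 \in D ->
  (forall F G, F \in facets D -> G \in facets D -> F0 \subset F ->
     F0 \subset G -> #|F :&: G| = d.-1 -> P F -> P G) ->
  forall F G, F \in facets D -> G \in facets D -> F0 \subset F ->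
     F0 \subset G -> P F -> P G.
Proof.
have [n] := ubnP (d - #|F0|); elim: n F0 => // n IHn F0 ltn F0D adjP F G Ffac Gfac sF sG PF.
have [->//|neFG] := eqVneq G F.
have leF0 : #|F0| <= d by rewrite -(card_facet Ffac) subset_leq_card.
have ltI : #|F :&: G| < d.
  rewrite -(card_facet Ffac) proper_card // properE subsetIl subsetI subxx /=.
  by apply: contra neFG => sFG; rewrite eq_sym eqEcard sFG (card_facet Ffac) (card_facet Gfac) leqnn.
have leI : #|F0| <= #|F :&: G| by rewrite subset_leq_card // subsetI sF.
(* If [F0] has at least [d - 1] vertices, two distinct facets through it are adjacent. *)
have [big|small] := leqP d (#|F0| + 1); first by apply: adjP PF => //; lia.
have cn : connected_complex (link D F0) by case: npmD => _ _ _ _; apply=> //; lia.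
have vert H : H \in facets D -> F0 \subset H ->
    exists2 x, x \in vertices (link D F0) & x |: F0 \subset H.
  move=> Hf sH; have : F0 \proper H by rewrite properEcard sH (card_facet Hf); lia.
  case/properP=> _ [x xH xF0]; exists x; last by rewrite subUset sub1set xH.
  rewrite !inE disjoints1 xF0 (scD.2 H) ?facet_face //.
  by rewrite subUset sub1set xH.
have [[x xV sx] [y yV sy]] := (vert F Ffac sF, vert G Gfac sG).
have IH z H : z |: F0 \in D -> z \notin F0 -> H \in facets D -> z |: F0 \subset H -> P H ->
    forall H', H' \in facets D -> z |: F0 \subset H' -> P H'.
  move=> zD zF0 Hf sH PH H' Hf' sH'.
  have le : #|z |: F0| <= d by rewrite -(card_facet Hf) subset_leq_card.
  have zE : #|z |: F0| = #|F0|.+1 by rewrite cardsU1 zF0.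
  have lt' : d - #|z |: F0| < n by rewrite zE subnS prednK ?subn_gt0 -?zE // -ltnS.
  apply: (IHn _ lt' zD _ H H') => // H1 H2 f1 f2 s1 s2; apply: adjP => //.
    by apply: subset_trans s1; rewrite subsetUr.
  by apply: subset_trans s2; rewrite subsetUr.
have {PF} Px : forall H, H \in facets D -> x |: F0 \subset H -> P H.
  by move: xV; rewrite !inE disjoints1 => /andP[xF0 xD]; apply: (IH _ F).
have /connectP[p pp ey] := cn x y xV yV.
suff: forall H, H \in facets D -> y |: F0 \subset H -> P H by apply.
(* A facet through [F0] and the link edge from [x] to [z] carries [P] from the facets at [x] to
   those at [z]. *)
rewrite {}ey; elim: p x Px pp {xV sx} => //= z p IHp x Px /andP[xz].
apply: IHp; move: xz; rewrite inE => /andP[dxz xzD].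
have [H Hf sH] := face_in_facet xzD.
have zF0 : z \notin F0.
  by rewrite (disjointFr dxz) // !inE eqxx orbT.
apply: (IH z H) => //.
- by apply: (scD.2 _ _ xzD); rewrite setSU // subsetUr.
- by apply: subset_trans sH; rewrite setSU // subsetUr.
by apply: Px => //; apply: subset_trans sH; rewrite setSU // subsetUl.
Qed.

End Facets.

Definition faces_in (T : finType) (D : {set {set T}}) k (M : {set T}) :=
  [set F in D | (#|F| == k) && (F \subset M)].

Lemma disjoint_setD (T : finType) (A B : {set T}) : [disjoint A & B :\: A].
Proof. by apply/pred0P => x /=; rewrite inE; case: (x \in A). Qed.

(** * Restriction to a vertex set meeting every facet in three vertices *)

Section RankSelection.
Variables (d : nat) (T : finType) (D : {set {set T}}).
Hypothesis scD : simplicial_complex D.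
Hypothesis npmD : normal_pseudomanifold d D.
Variable M : {set T}.
Hypothesis card_facetI : forall F, F \in facets D -> #|F :&: M| = 3.
Implicit Types (F G H U : {set T}).

Section Link.
Variable F0 : {set T}.
Hypothesis F0fac : F0 \in facets D.
Let C := F0 :\: M.

(** The facets of the link of [C]: a facet through [C] has no further vertex outside [M]. *)
Definition link_tris := [set G : {set T} | (G \subset M) && (G :|: C \in facets D)].

Lemma card_outside : #|C| + 3 = d.
Proof. by rewrite -(card_facet npmD F0fac) -(card_facetI F0fac) addnC cardsID. Qed.

Lemma link_triE G : G \subset M -> (G :|: C) :&: M = G.
Proof.
move=> sGM; rewrite setIUl (setIidPl sGM) /C; apply/setP => x; rewrite !inE.
by case: (x \in M); rewrite ?andbF ?orbF.
Qed.

Lemma facet_outside H : H \in facets D -> C \subset H -> H :\: M = C.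
Proof.
move=> Hf sC; apply/eqP; rewrite eq_sym eqEcard; apply/andP; split.
  by rewrite subsetD sC disjoint_sym disjoint_setD.
rewrite -(leq_add2r 3) card_outside -(card_facetI Hf) addnC cardsID.
by rewrite (card_facet npmD Hf).
Qed.

Lemma facet_linkK H : H \in facets D -> C \subset H -> (H :&: M) :|: C = H.
Proof. by move=> Hf sC; rewrite -(facet_outside Hf sC) setID. Qed.

Lemma facet_link_tris H : H \in facets D -> C \subset H -> H :&: M \in link_tris.
Proof. by move=> Hf sC; rewrite inE subsetIr facet_linkK. Qed.

Lemma link_tris_facet G : G \in link_tris -> G :|: C \in facets D.
Proof. by rewrite inE => /andP[]. Qed.

Lemma link_tris_sub G : G \in link_tris -> G \subset M.
Proof. by rewrite inE => /andP[]. Qed.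

Lemma card_link_tris G : G \in link_tris -> #|G| = 3.
Proof. by rewrite inE => /andP[sG /card_facetI]; rewrite link_triE. Qed.

Lemma card_setU_outside G : G \subset M -> #|G :|: C| = #|G| + #|C|.
Proof.
move=> sG; rewrite cardsU (_ : G :&: C = set0) ?cards0 ?subn0 //.
by apply/setP => x; rewrite !inE; case xG: (x \in G) => //; rewrite (subsetP sG).
Qed.

(** Adding [C] is a bijection from the triangles through [e] to the facets through [e :|: C], a face
    with [d - 1] vertices. *)
Lemma link_tris_two (e G : {set T}) :
  G \in link_tris -> e \subset G -> #|e| = 2 ->
  #|[set H in link_tris | e \subset H]| = 2.
Proof.
move=> GS sG e2; have [_ _ _ two _] := npmD.
have sM : e \subset M := subset_trans sG (link_tris_sub GS).
rewrite -(two (e :|: C)); first last.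
- by rewrite card_setU_outside // e2 -card_outside addnC !addnS.
- by apply: scD.2 (facet_face (link_tris_facet GS)) _; rewrite setSU.
rewrite -[LHS](@card_in_imset _ _ (fun H => H :|: C)) => [|H1 H2]; last first.
  rewrite !inE => /andP[/andP[s1 _] _] /andP[/andP[s2 _] _] e12.
  by rewrite -(link_triE s1) e12 link_triE.
apply: eq_card => H; rewrite [RHS]inE; apply/imsetP/andP => [[K]|[Hf]].
  by rewrite inE => /andP[KS sK] ->; rewrite link_tris_facet // setSU.
rewrite subUset => /andP[sH sC]; exists (H :&: M); last by rewrite facet_linkK.
by rewrite inE facet_link_tris // subsetI sH.
Qed.

(** Strong connectivity of the facets through [e :|: C]. A single vertex [e] gives connected stars,
    the empty [e] a connected surface. *)
Lemma link_tris_connected (e : {set T}) (P : pred {set T}) :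
  e \subset M ->
  (forall F G, F \in link_tris -> G \in link_tris -> e \subset F ->
     e \subset G -> #|F :&: G| = 2 -> P F -> P G) ->
  forall F G, F \in link_tris -> G \in link_tris -> e \subset F ->
     e \subset G -> P F -> P G.
Proof.
move=> sM adjP F G FS GS sF sG PF.
have FE := link_triE (link_tris_sub FS); have GE := link_triE (link_tris_sub GS).
rewrite -GE; move: (PF); rewrite -{1}FE.
apply: (@strongly_connected d _ D scD npmD (fun H => P (H :&: M)) (e :|: C));
  rewrite ?setSU ?link_tris_facet //.
  by apply: scD.2 (facet_face (link_tris_facet FS)) _; rewrite setSU.
move=> H1 H2 f1 f2; rewrite !subUset => /andP[e1 C1] /andP[e2 C2] I.
apply: adjP; rewrite ?facet_link_tris ?subsetI ?e1 ?e2 //.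
(* Two adjacent facets share all [d - 3] vertices of [C], hence exactly two vertices of [M]. *)
have : #|(H1 :&: H2) :&: M| + #|(H1 :&: H2) :\: M| = d.-1 by rewrite cardsID.
rewrite -setIIl setDIl !facet_outside // setIid -card_outside.
by rewrite (addnS _ 2) /= addnC => /addnI.
Qed.

Lemma link_edges_ge3 U :
  U \subset M -> F0 :&: M \subset U ->
  3 * #|cover link_tris :\: U| <= #|edges_at link_tris (cover link_tris :\: U)|.
Proof.
move=> sUM sF0.
have F0S : F0 :&: M \in link_tris by rewrite facet_link_tris // subsetDl.
apply: (@edges_at_ge3 _ _ card_link_tris link_tris_two _ _ _ (F0 :&: M)) => //.
- move=> w P adjP F G FS GS wF wG PF.
  apply: (@link_tris_connected [set w] P _ _ F G); rewrite ?sub1set //.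
    exact: subsetP (link_tris_sub FS) _ wF.
  by move=> H1 H2 S1 S2; rewrite !sub1set; apply: adjP.
- move=> P adjP F G FS GS PF.
  apply: (@link_tris_connected set0 P _ _ F G); rewrite ?sub0set //.
  by move=> H1 H2 S1 S2 _ _; apply: adjP.
- by move=> w; rewrite inE => /andP[_ /bigcupP[F FS wF]]; exists F.
- exact: disjointWl sF0 (disjoint_setD _ _).
Qed.

End Link.

(* A maximal [U] containing a triangle and satisfying the inequality contains the
   [M]-part of every facet: otherwise two adjacent facets disagree, they have the
   same part outside [M], and the vertices of the corresponding link can be added
   to [U]. *)
Lemma faces_in_ge : 3 * #|faces_in D 1 M| <= #|faces_in D 2 M| + 6.
Proof.
have [F0 F0fac _] := face_in_facet scD.1.
pose good U := [&& U \subset M, [exists F in facets D, F :&: M \subset U]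
                 & 3 * #|U| <= #|faces_in D 2 U| + 6].
(* A triangle satisfies the inequality with equality: 3 * 3 = 3 + 6. *)
have good0 : good (F0 :&: M).
  apply/and3P; split; first exact: subsetIr.
    by apply/exists_inP; exists F0.
  rewrite (_ : faces_in D 2 _ = [set e : {set T} | e \subset F0 :&: M & #|e| == 2]).
    by rewrite cards_draws card_facetI.
  apply/setP => e; rewrite !inE.
  rewrite [(#|e| == 2) && _]andbC andb_idl // => /andP[se _].
  by apply: scD.2 (facet_face F0fac) _; apply: subset_trans se (subsetIl _ _).
have [U /maxsetP[/and3P[sUM /exists_inP[F1 F1fac sF1] geU] maxU] _] := maxset_exists good0.
have allU F : F \in facets D -> F :&: M \subset U.
  move=> Ffac; apply: (@strongly_connected d _ D scD npmD (fun H => H :&: M \subset U) set0 scD.1 _ F1);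
    rewrite ?sub0set // => {Ffac}F G Ffac Gfac _ _ I sF.
  apply: contraT => nsG.
  (* [F :&: G] has [d - 1] vertices, at most two of them in [M], so it contains all [d - 3] vertices
     of [F] outside [M]. *)
  have sC : F :\: M \subset G.
    have : #|(F :&: G) :&: M| + #|(F :&: G) :\: M| = d.-1 by rewrite cardsID.
    have lt3 : #|(F :&: G) :&: M| < 3.
      rewrite -(card_facetI Gfac); apply/proper_card/properP; split.
        by rewrite setSI // subsetIr.
      case/subsetPn: nsG => x; rewrite inE => /andP[xG xM] xU; exists x.
        by rewrite inE xG.
      by apply: contra xU; rewrite !inE => /andP[/andP[xF _] _]; rewrite (subsetP sF) // inE xF.
    rewrite -(card_outside Ffac) => e.
    have le : #|F :\: M| <= #|(F :&: G) :\: M|.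
      by move: e lt3; move: #|_| #|_| #|_| => a b c; clear; lia.
    have /eqP <- : (F :&: G) :\: M == F :\: M by rewrite eqEcard setSD ?subsetIl.
    by apply: subset_trans (subsetDl _ _) (subsetIr _ _).
  set W := cover (link_tris F) :\: U.
  have coverM : cover (link_tris F) \subset M.
    by apply/bigcupsP => H; apply: link_tris_sub.
  (* [U :|: W] is again good, since the new vertices are paid for by the edges meeting [W], none of
     which lies inside [U]. *)
  have UE : U :|: W = U.
    apply: maxU; last exact: subsetUl.
    apply/and3P; split.
    - by rewrite subUset sUM (subset_trans (subsetDl _ _)).
    - by apply/exists_inP; exists F => //; apply: subset_trans sF (subsetUl _ _).
    rewrite cardsU (_ : U :&: W = set0) ?cards0 ?subn0; last exact: disjoint_setI0 (disjoint_setD _ _).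
    have := link_edges_ge3 Ffac sUM sF; rewrite -/W => geW.
    rewrite mulnDr; apply: leq_trans (leq_add geU geW) _.
    rewrite addnAC leq_add2r -cardsUI (_ : _ :&: _ = set0) ?cards0 ?addn0; last first.
      apply/setP => e; rewrite !inE; apply/negP => /andP[/and3P[_ _ seU] /andP[_]].
      by apply/negP; rewrite negbK; apply: disjointWl seU (disjoint_setD _ _).
    apply/subset_leq_card; rewrite subUset; apply/andP; split; apply/subsetP => e; rewrite !inE.
      by case/and3P=> -> -> se; apply: subset_trans se (subsetUl _ _).
    case/andP=> /tri_edgeP[-> [H HS sH]] _; rewrite eqxx /=; apply/andP; split.
      apply: scD.2 (facet_face (link_tris_facet HS)) _.
      exact: subset_trans sH (subsetUl _ _).
    apply: subset_trans sH _; apply/subsetP => x xH; rewrite !inE.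
    by case: (x \in U) => //=; apply/bigcupP; exists H.
  case/negP: nsG; rewrite -UE /W; apply/subsetP => x xG; rewrite !inE.
  case: (x \in U) => //=; apply/bigcupP; exists (G :&: M) => //.
  exact: facet_link_tris.
have sV : #|faces_in D 1 M| <= #|U|.
  rewrite -(card_imset _ (@set1_inj T)); apply/subset_leq_card/subsetP => v.
  rewrite inE => /and3P[vD /cards1P[x vE] sv]; move: vD sv; rewrite vE sub1set => vD xM.
  apply/imsetP; exists x => //; have [H Hf] := face_in_facet vD.
  by rewrite sub1set => xH; rewrite (subsetP (allU H Hf)) // inE xH.
have sE : #|faces_in D 2 U| <= #|faces_in D 2 M|.
  apply/subset_leq_card/subsetP => e; rewrite !inE => /and3P[-> -> se].
  exact: subset_trans se sUM.
by move: geU sV sE; move: #|_| #|_| #|_| #|_| => a b c e; clear; lia.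
Qed.

End RankSelection.

(** * Colour classes *)

Section Coloring.
Variables (d : nat) (T : finType) (D : {set {set T}}) (V : 'I_d -> {set T}).
Hypothesis scD : simplicial_complex D.
Hypothesis coverV : \bigcup_i V i = vertices D.
Hypothesis disjV : forall i j, i != j -> [disjoint V i & V j].
Hypothesis rainbow : forall F i, F \in D -> #|F :&: V i| <= 1.
Implicit Types (F : {set T}) (K : {set 'I_d}).

Definition colors F := [set i | F :&: V i != set0].
Definition class K := \bigcup_(i in K) V i.

Lemma face_sub_cover F : F \in D -> F \subset \bigcup_i V i.
Proof.
move=> FD; apply/subsetP => x xF; rewrite coverV inE.
by apply: scD.2 FD _; rewrite sub1set.
Qed.

(** A face is the disjoint union of its traces on the colour classes, each empty or a single
    vertex. *)
Lemma card_colors F : F \in D -> #|colors F| = #|F|.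
Proof.
move=> FD; rewrite -!sum1_card; rewrite -[in RHS](setIidPl (face_sub_cover FD)) big_distrr /=.
rewrite (@partition_disjoint_bigcup _ _ _ _ _ (fun i => F :&: V i)) => [|i j /disjV dij]; last first.
  exact: disjointW (subsetIr _ _) (subsetIr _ _) dij.
rewrite big_mkcond /=; apply: eq_bigr => i _; rewrite inE sum1_card -cards_eq0.
by case: #|F :&: V i| (rainbow i FD) => [|[|]].
Qed.

Lemma sub_class F K : F \in D -> (F \subset class K) = (colors F \subset K).
Proof.
move=> FD; apply/subsetP/subsetP => [sF i|sF x xF].
  rewrite inE => /set0Pn[x]; rewrite inE => /andP[/sF/bigcupP[j jK xj] xi].
  by have [->//|/disjV/disjointFr/(_ xi)] := eqVneq i j; rewrite xj.
have /bigcupP[i _ xi] := subsetP (face_sub_cover FD) x xF.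
by apply/bigcupP; exists i => //; apply: sF; rewrite inE; apply/set0Pn; exists x; rewrite inE xF.
Qed.

(** A face with [d] vertices uses every colour, so its trace on [class K] has exactly the colours in
    [K]. *)
Lemma card_facetI_class F K : F \in D -> #|F| = d -> #|F :&: class K| = #|K|.
Proof.
move=> FD Fd; have colF : colors F = setT.
  by apply/eqP; rewrite eqEcard subsetT cardsT card_ord card_colors // Fd /=.
rewrite -card_colors; last by apply: scD.2 FD _; apply: subsetIl.
apply: eq_card => i; rewrite inE; apply/set0Pn/idP => [[x]|iK].
  rewrite !inE => /andP[/andP[_ /bigcupP[j jK xj]] xi].
  by have [->//|/disjV/disjointFr/(_ xi)] := eqVneq i j; rewrite xj.
have : i \in colors F by rewrite colF inE.
rewrite inE => /set0Pn[x]; rewrite inE => /andP[xF xi].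
by exists x; rewrite !inE xF xi andbT; apply/bigcupP; exists i.
Qed.

(** A face with [k] vertices is counted once for each colour set of size [m] containing its [k]
    colours. *)
Lemma sum_faces_in k m : k <= m ->
  \sum_(K : {set 'I_d} | #|K| == m) #|faces_in D k (class K)|
    = Defs.fcard D k * 'C(d - k, m - k).
Proof.
move=> lekm; rewrite /Defs.fcard -sum_nat_const.
under [LHS]eq_bigr do rewrite /faces_in -sum1dep_card.
rewrite (exchange_big_dep (fun F => F \in [set F in D | #|F| == k])) /=; last first.
  by move=> K F _ /and3P[FD Fk _]; rewrite inE FD.
apply: eq_bigr => F; rewrite inE => /andP[FD /eqP Fk].
have sT : colors F \subset setT by apply: subsetT.
have := card_draws_between sT; rewrite card_colors // Fk cardsT card_ord => /(_ m lekm) <-.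
rewrite sum1dep_card; apply: eq_card => K; rewrite !inE FD eqxx sub_class //=.
by rewrite subsetT /= andbC.
Qed.

End Coloring.

(** This is [faces_in_ge] summed over all triples of colours. *)
Lemma balanced_face_numbers (d : nat) (T : finType) (D : {set {set T}}) :
  simplicial_complex D -> balanced d D -> normal_pseudomanifold d D ->
  3 * (Defs.fcard D 1 * 'C(d - 1, 2)) <= Defs.fcard D 2 * (d - 2) + 6 * 'C(d, 3).
Proof.
move=> scD [_ [V [coverV disjV rainbow]]] npmD.
rewrite -[d - 2 in leqRHS]bin1 -!(sum_faces_in scD coverV disjV rainbow (m := 3)) //.
rewrite (_ : 6 * _ = \sum_(K : {set 'I_d} | #|K| == 3) 6); last first.
  by rewrite sum_nat_cond_const card_draws card_ord mulnC.
rewrite -big_split big_distrr /=; apply: leq_sum => K /eqP K3.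
apply: (faces_in_ge scD npmD) => F Ff.
rewrite -K3; apply: (card_facetI_class scD coverV disjV rainbow _ (facet_face Ff)).
exact: (card_facet npmD Ff).
Qed.

Local Open Scope ring_scope.

Theorem theorem3p4 (d : nat) (T : finType) (D : {set {set T}}) :
  (3 <= d)%N -> simplicial_complex D -> balanced d D ->
  normal_pseudomanifold d D ->
  0 <= balanced_gnum d D 2 /\
  (d%:Z - 1) * hnum d D 1 <= 2 * hnum d D 2.
Proof.
move=> d3 scD balD npmD.
have := balanced_face_numbers scD balD npmD.
case: d d3 {balD npmD} => [|[|[|n]]] // _.
have f0 : Defs.fcard D 0 = 1%N.
  rewrite /Defs.fcard (_ : [set F in D | #|F| == 0%N] = [set set0]) ?cards1 //.
  apply/setP => F; rewrite !inE cards_eq0 andb_idl // => /eqP ->.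
  exact: scD.1.
rewrite /balanced_gnum /hnum /= !big_nat_recr ?big_geq //= !add0r f0.
rewrite ?subSS ?subn0 ?subnn ?binn sqrrN expr1n expr1 expr0.
have e1 : 'C(n.+3, n.+2) = n.+3 by rewrite -bin_sub // subSn // subnn bin1.
have e2 : 'C(n.+2, n.+1) = n.+2 by rewrite -bin_sub // subSn // subnn bin1.
have e3 : ('C(n.+3, n.+1) * 2 = n.+3 * n.+2)%N.
  rewrite (_ : 'C(n.+3, n.+1) = 'C(n.+3, 2)); last first.
    by rewrite -(@bin_sub n.+3 2) // !subSS subn0.
  rewrite -[X in (_ * X)%N = _]/(2`!)%N bin_ffact.
  by rewrite !ffactnS ffactn0 /= muln1.
have e4 : ('C(n.+2, 2) * 2 = n.+2 * n.+1)%N.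
  by rewrite -[X in (_ * X)%N = _]/(2`!)%N bin_ffact !ffactnS ffactn0 /= muln1.
have e5 : ('C(n.+3, 3) * 6 = n.+3 * (n.+2 * n.+1))%N.
  by rewrite -[X in (_ * X)%N = _]/(3`!)%N bin_ffact !ffactnS ffactn0 /= muln1.
rewrite {}e1 {}e2; move: e3 e4 e5.
move: 'C(n.+3, n.+1) 'C(n.+2, 2) 'C(n.+3, 3) (Defs.fcard D 1) (Defs.fcard D 2) => b3 b4 b5 f1 f2.
clear=> e3 e4 e5 le.
(* With d = n + 3, the claim reads 2 f2 - 3 (d - 1) f1 + 2 d (d - 1) >= 0, where [f1] counts
   vertices and [f2] edges. It is twice the summed inequality divided by d - 2 = n + 1. *)
have key : (3 * (f1 * n.+2) <= f2 * 2 + 2 * (n.+3 * n.+2))%N.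
  rewrite -(leq_pmul2r (ltn0Sn n)).
  have : (3 * f1 * (b4 * 2) <= 2 * (f2 * n.+1) + 2 * (b5 * 6))%N by lia.
  by rewrite e4 e5; lia.
by split; lia.
Qed.
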